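(* Let $\mu,\delta\in\mathbb{R}$ and $\sigma,\alpha,\theta>0$, and let $Y=\{Y_t\}_{t\ge0}$ be the Lévy process on $\mathbb{R}$ generated by the Variance-Gamma model with parameters $(\mu,\delta,\sigma,\alpha,\theta)$. Put $a=\mu+\alpha\theta\delta$ and $b^2=\alpha(\theta^2\delta^2+\sigma^2\theta)$, $b>0$. Then $Y_t$ is asymptotically distributed as $N(ta,tb^2)$ as $t\to+\infty$, i.e. $$\frac{Y_t-ta}{b\sqrt t}\longrightarrow N(0,1)\quad\text{in distribution as } t\to+\infty.$$
   Context: The Lévy process generated by the Variance-Gamma (VG) model with parameters $(\mu,\delta,\sigma,\alpha,\theta)$ is the Lévy process $Y$ with $$E\left[e^{i\xi Y_t}\right]=\frac{e^{it\mu\xi}}{\left(1-i\delta\theta\xi+\frac12\sigma^2\theta\xi^2\right)^{t\alpha}},\qquad \xi\in\mathbb{R},\ t\ge0,$$ where the complex power is taken with the principal branch (the base has real part $\ge1$). $N(m,v)$ denotes the normal law with mean $m$ and variance $v$. *)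

(* Defs.v *)
From HB Require Import structures.
From mathcomp Require Import all_boot all_order all_algebra.
From mathcomp Require Import all_classical all_reals all_analysis.
From mathcomp Require Import measurable_realfun complex.

Set Implicit Arguments.
Unset Strict Implicit.
Unset Printing Implicit Defensive.

Import Order.TTheory GRing.Theory Num.Theory.
Import numFieldTopology.Exports numFieldNormedType.Exports.

Local Open Scope classical_set_scope.
Local Open Scope ring_scope.
Local Open Scope complex_scope.

Definition cexp (R : realType) (z : R[i]) : R[i] :=
  (expR (complex.Re z) * cos (complex.Im z))
    +i* (expR (complex.Re z) * sin (complex.Im z)).

(* Principal argument, with values in ]-pi, pi] for z != 0. *)
Definition carg (R : realType) (z : R[i]) : R :=
  let a := acos (complex.Re z / ComplexField.Normc.normc z) in
  if 0 <= complex.Im z then a else - a.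

(* Principal logarithm and power; the values at z = 0 are junk. *)
Definition clog (R : realType) (z : R[i]) : R[i] :=
  ln (ComplexField.Normc.normc z) +i* carg z.

Definition cpow (R : realType) (z w : R[i]) : R[i] := cexp (w * clog z).

Section probability.
Context d (T : measurableType d) (R : realType) (P : probability T R).

(* [fine] turns an infinite or undefined expectation into 0; the expectation is
   finite whenever Z is measurable and bounded. *)
Definition cexpectation (Z : T -> R[i]) : R[i] :=
  fine 'E_P[fun w => complex.Re (Z w)] +i* fine 'E_P[fun w => complex.Im (Z w)].

Definition char_fun (X : {RV P >-> R}) (xi : R) : R[i] :=
  cexpectation (fun w => cexp ('i%C * (xi * X w)%:C)).

(* A measure is a total function on [set R]: laws are only compared on
   measurable sets. *)
Definition same_law (X X' : {RV P >-> R}) : Prop :=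
  forall A : set R, measurable A -> distribution P X A = distribution P X' A.

Definition mutually_independent (I : finType) (X : I -> {RV P >-> R}) : Prop :=
  forall (J : {set I}) (B : I -> set R), (forall i, measurable (B i)) ->
    P (\bigcap_(i in [set` J]) X i @^-1` B i) =
    (\prod_(i in J) P (X i @^-1` B i))%E.

Definition cadlag (f : R -> R) : Prop :=
  forall t : R, 0 <= t ->
    f s @[s --> t^'+] --> f t /\ (0 < t -> cvg (f s @[s --> t^'-])).

Definition increment (Y : R -> {RV P >-> R}) (s t : R) : {RV P >-> R} :=
  (Y t : {mfun T >-> R}) - Y s.

(* Y is indexed by all of R, but only its values at times t >= 0 matter. *)
Record Levy_process (Y : R -> {RV P >-> R}) : Prop := {
  Levy_start : {ae P, forall w, Y 0 w = 0} ;
  Levy_independent : forall (n : nat) (s : nat -> R), 0 <= s 0%N ->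
    (forall i, (i < n)%N -> s i < s i.+1) ->
    mutually_independent (fun i : 'I_n => increment Y (s i) (s i.+1)) ;
  Levy_stationary : forall s t : R, 0 <= s -> 0 <= t ->
    same_law (increment Y s (s + t)) (increment Y 0 t) ;
  Levy_stochastic_continuity : forall t e : R, 0 <= t -> 0 < e ->
    P [set w | e < `|Y s w - Y t w|] @[s --> within `[0, +oo[ (nbhs t)]
      --> 0%E ;
  Levy_cadlag : {ae P, forall w, cadlag (fun t => Y t w)} }.

Definition VG_Levy_process (mu delta sigma alpha theta : R)
    (Y : R -> {RV P >-> R}) : Prop :=
  Levy_process Y /\
  forall t xi : R, 0 <= t ->
    char_fun (Y t) xi =
    cexp ('i%C * (t * mu * xi)%:C) /
    cpow (1 - 'i%C * (delta * theta * xi)%:C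
            + (2^-1 * sigma ^+ 2 * theta * xi ^+ 2)%:C)
         (t * alpha)%:C.

Definition normalize (X : {RV P >-> R}) (m s : R) : {RV P >-> R} :=
  ((X : {mfun T >-> R}) - cst m) * cst s^-1.

(* The distribution functions converge at every continuity point of that of the
   limit law. *)
Definition cvg_in_distribution (I : Type) (F : set_system I)
    (X : I -> {RV P >-> R}) (nu : probability (measurableTypeR R) R) : Prop :=
  forall x : R, {for x, continuous (fun y : R => nu `]-oo, y]%classic)} ->
    cdf (X t) x @[t --> F] --> nu `]-oo, x]%classic.

End probability.

(* Main.v *)
Require Import Defs.
From HB Require Import structures.
From mathcomp Require Import all_boot all_order all_algebra.
From mathcomp Require Import all_classical all_reals all_analysis.
From mathcomp Require Import ring lra measurable_realfun complex.

(* Only the marginal characteristic functions of Y matter.  Writing them as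
   E[cos (s Y_t + q)] = rho cos (A + q) with an explicit modulus rho and phase
   A, the normalized variables satisfy
   E[cos (xi X_t + p)] -> cos p exp (- xi^2 / 2) for all xi and p: the logarithm
   of the modulus is expanded to first order and the phase
   atan v - delta theta s is cubic in s = O(t^(-1/2)).
   The limit is the characteristic function of N(0,1), so the result follows
   from Levy's continuity theorem.  The latter is proved by convolving with a
   small centred Gaussian: the Gaussian density is itself a mixture of cosines,
   hence the smoothed laws of intervals converge by Fubini and dominated
   convergence, and the Gaussian tail bounds the smoothing error.  As the limit
   has total mass 1, lower bounds on intervals already give convergence of the
   distribution functions.  Keeping a free phase p in cos (xi x + p) covers sine
   and cosine at once and avoids complex integrals. *)

Set Implicit Arguments.
Unset Strict Implicit.
Unset Printing Implicit Defensive.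

Import Order.TTheory GRing.Theory Num.Theory.
Import numFieldTopology.Exports numFieldNormedType.Exports.

Local Open Scope classical_set_scope.
Local Open Scope ring_scope.

(** * The characteristic function and the tails of the normal law *)

Section normal_characteristic_function.
Context {R : realType}.
Local Notation leb := (@lebesgue_measure R).
Implicit Types (m s h x y p xi : R).

(** The density agrees almost everywhere with the Radon-Nikodym derivative, since both have the same
    integral over every measurable set. *)
Lemma integral_normal_prob m s (f : R -> \bar R) :
  (normal_prob m s).-integrable setT f ->
  (\int[normal_prob m s]_x f x = \int[leb]_x (f x * (normal_pdf m s x)%:E))%E.
Proof.
move=> intf.
have mf : measurable_fun setT f by exact: measurable_int intf.
rewrite -(Radon_Nikodym_change_of_variables (@normal_prob_dominates R m s))//=.
apply: ae_eq_integral => //.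
- apply: emeasurable_funM => //; apply: (measurable_int leb).
  by apply: Radon_Nikodym_integrable; exact: normal_prob_dominates.
- apply: emeasurable_funM => //=; apply/measurableT_comp => //=.
  exact: measurable_normal_pdf.
- apply: ae_eqe_mul2l => /=.
  rewrite Radon_NikodymE//=; first exact: normal_prob_dominates.
  move=> dom; case: cid => /= h [h1 h2 h3].
  apply: integral_ae_eq => //=.
  + by apply/measurableT_comp => //; exact: measurable_normal_pdf.
  + by move=> E _ mE; rewrite -h3.
Qed.

Lemma normal_pdf01E x :
  normal_pdf 0 1 x = normal_peak 1 * expR (- (x ^+ 2 / 2)).
Proof.
by rewrite normal_pdfE ?oner_eq0// /normal_fun subr0 expr1n mulNr.
Qed.

(** The exponent is cut into two equal halves: one is bounded through $|x-m|\ge h$, the other is the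
    exponent of the normal law with doubled variance. The factor $\sqrt2$ is the ratio of the two
    peaks. *)
Lemma normal_pdf_half_variance_le m s h x : s != 0 -> 0 <= h -> h <= `|x - m| ->
  normal_pdf m s x <= Num.sqrt 2 * expR (- (h ^+ 2 / (4 * s ^+ 2)))
                      * normal_pdf m (Num.sqrt 2 * s) x.
Proof.
move=> s0 h0 hx.
have s20 : Num.sqrt 2 * s != 0 :> R by rewrite mulf_neq0// gt_eqF// sqrtr_gt0.
rewrite !normal_pdfE// /normal_peak /normal_fun exprMn sqr_sqrtr//.
rewrite -mulrnAr -[_ * _ *+ 2]mulrnAr -(mulrA 2) (sqrtrM (_ * _)) ?ler0n//.
have q0 : Num.sqrt 2 != 0 :> R by rewrite gt_eqF// sqrtr_gt0.
have k0 : 0 < Num.sqrt (s ^+ 2 * (pi *+ 2)) :> R.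
  rewrite sqrtr_gt0; apply: mulr_gt0; first by rewrite exprn_even_gt0.
  by rewrite pmulrn_lgt0 ?pi_gt0.
rewrite (invfM (Num.sqrt 2)).
have -> (a b c : R) : Num.sqrt 2 * a * ((Num.sqrt 2)^-1 * b * c) = b * (a * c).
  by field.
rewrite ler_pM2l ?invr_gt0// -expRD ler_expR.
have hx2 : h ^+ 2 <= (x - m) ^+ 2.
  by rewrite -[leRHS]real_normK ?num_real// lerXn2r// nnegrE.
have s2 : 0 < s ^+ 2 by rewrite exprn_even_gt0.
rewrite -subr_ge0.
have -> : - (h ^+ 2 / (4 * s ^+ 2)) + - (x - m) ^+ 2 / ((2 * s ^+ 2) *+ 2) -
  - (x - m) ^+ 2 / (s ^+ 2 *+ 2) = ((x - m) ^+ 2 - h ^+ 2) / (4 * s ^+ 2).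
  by rewrite -[_ *+ 2]mulr_natl -[(s ^+ 2) *+ 2]mulr_natl; field.
by rewrite divr_ge0 ?subr_ge0// mulr_ge0// ltW.
Qed.

Lemma measurable_normr_sub_ge m h : measurable [set x : R | h <= `|x - m|].
Proof.
rewrite -[X in measurable X]setTI.
apply: (@measurable_fun_le _ _ R setT (cst h) (fun x => `|x - m|)) => //.
by apply: measurableT_comp => //; exact: measurable_funB.
Qed.

(** Integrating the previous bound suffices, because the wider density has total mass 1. *)
Lemma normal_prob_tail_le m s h : s != 0 -> 0 <= h ->
  (normal_prob m s [set x | (h <= `|x - m|)%R]
    <= (Num.sqrt 2 * expR (- (h ^+ 2 / (4 * s ^+ 2))))%:E)%E.
Proof.
move=> s0 h0; rewrite /normal_prob.
set c := Num.sqrt 2 * _.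
have c0 : 0 <= c by rewrite mulr_ge0 ?sqrtr_ge0 ?expR_ge0.
set A := [set x | _].
have mA : measurable A by exact: measurable_normr_sub_ge.
have mp s' : measurable_fun setT (fun x => (normal_pdf m s' x)%:E).
  by apply/measurable_EFinP; exact: measurable_normal_pdf.
apply: (@le_trans _ _ (\int[leb]_(x in A)
    (c%:E * (normal_pdf m (Num.sqrt 2 * s) x)%:E))%E).
  apply: ge0_le_integral => //=.
  - by move=> x _; rewrite lee_fin normal_pdf_ge0.
  - by apply: measurable_funTS; exact: mp.
  - by apply: measurable_funTS; apply: measurable_funeM; exact: mp.
  - by move=> x hx; rewrite -EFinM lee_fin; exact: normal_pdf_half_variance_le.
apply: (@le_trans _ _
    (\int[leb]_x (c%:E * (normal_pdf m (Num.sqrt 2 * s) x)%:E))%E).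
  apply: ge0_subset_integral => //=.
  - by apply: measurable_funeM; exact: mp.
  - by move=> x _; rewrite mule_ge0 ?lee_fin// normal_pdf_ge0.
rewrite ge0_integralZl//.
- by rewrite integral_normal_pdf mule1.
- exact: mp.
- by move=> x _; rewrite lee_fin normal_pdf_ge0.
Qed.

Lemma measurable_cos_affine xi p :
  measurable_fun setT (fun x : R => cos (xi * x + p)).
Proof.
apply: (@measurableT_comp _ _ _ _ _ _ (@cos R)).
  by apply: continuous_measurable_fun; exact: continuous_cos.
by apply: measurable_funD => //; exact: measurable_funM.
Qed.

Lemma measurable_sin_affine xi p :
  measurable_fun setT (fun x : R => sin (xi * x + p)).
Proof.
apply: (@measurableT_comp _ _ _ _ _ _ (@sin R)).
  by apply: continuous_measurable_fun; exact: continuous_sin.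
by apply: measurable_funD => //; exact: measurable_funM.
Qed.

Lemma integrable_bounded_normal_pdf m s (f : R -> R) : measurable_fun setT f ->
  (forall x, `|f x| <= 1) ->
  leb.-integrable setT (fun x => (f x * normal_pdf m s x)%:E).
Proof.
move=> mf f1; apply: le_integrable (integrable_normal_pdf m s) => //.
  by apply/measurable_EFinP/measurable_funM => //; exact: measurable_normal_pdf.
move=> x _; by rewrite lee_fin normrM ler_piMl.
Qed.

(** The half-variance bound with [h] equal to $|x|$ leaves a factor $e^{-x^2/4}$, which absorbs
    $|x|$: $|x|\le 1+x^2/4\le e^{x^2/4}$, the first inequality being $(|x|-2)^2\ge0$. *)
Lemma normr_mul_normal_pdf01_le x :
  `|x| * normal_pdf 0 1 x <= Num.sqrt 2 * normal_pdf 0 (Num.sqrt 2) x.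
Proof.
have := @normal_pdf_half_variance_le 0 1 `|x| x (oner_neq0 _) (normr_ge0 _).
rewrite subr0 lexx mulr1 expr1n mulr1 real_normK ?num_real// => /(_ isT).
move/(ler_wpM2l (normr_ge0 x))/le_trans; apply.
set e := expR _.
have -> (a b c : R) : a * (b * e * c) = b * (a * e * c) by ring.
rewrite ler_wpM2l ?sqrtr_ge0// ler_piMl ?normal_pdf_ge0//.
rewrite /e {e}.
rewrite expRN ler_pdivrMr ?expR_gt0// mul1r (le_trans _ (expR_ge1Dx _))//.
rewrite -[x ^+ 2]real_normK ?num_real//.
by set y := `|x|; have := sqr_ge0 (y - 2); lra.
Qed.

Lemma integrable_normr_normal_pdf01 :
  leb.-integrable setT (fun x => (`|x| * normal_pdf 0 1 x)%:E).
Proof.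
have ig := integrable_normal_pdf (0 : R) (Num.sqrt 2).
have := integrableZl measurableT (Num.sqrt 2) ig; apply: le_integrable => //.
- by apply/measurable_EFinP/measurable_funM => //; exact: measurable_normal_pdf.
- move=> x _; rewrite -EFinM /= lee_fin ger0_norm ?mulr_ge0 ?normal_pdf_ge0//.
  exact: (le_trans (normr_mul_normal_pdf01_le x) (ler_norm _)).
Qed.

Lemma cvg_integral_symmetric_itv (f : R -> \bar R) : leb.-integrable setT f ->
  (\int[leb]_(x in `[(- n%:R)%R, n%:R]) f x)%E @[n --> \oo]
    --> (\int[leb]_x f x)%E.
Proof.
move=> intf.
under eq_cvg do rewrite integral_mkcond.
have mf : measurable_fun setT f by exact: measurable_int intf.
have [] // := @dominated_convergence _ _ R leb setT measurableT
  (fun n => f \_ `[(- n%:R)%R, n%:R]) f (abse \o f).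
- move=> n; apply: (iffLR (measurable_restrictT _ _)).
    exact: measurable_itv.
  by apply: measurable_funTS; exact: mf.
- apply: aeW => x _; apply: cvg_near_cst; near=> n.
  rewrite patchE mem_set//= in_itv/= -ler_norml.
  by near: n; exact: nbhs_infty_ger.
- exact: integrable_abse.
- apply: aeW => x n _; rewrite patchE; case: ifP => //.
  by rewrite abse0 abse_ge0.
Unshelve. all: end_near. Qed.

(** The fundamental theorem of calculus on $[-n,n]$ leaves only boundary terms, which vanish in the
    limit. *)
Lemma integral_derivative_eq0 (F f : R -> R) :
  (forall x, is_derive x 1 F (f x)) -> continuous f ->
  leb.-integrable setT (EFin \o f) ->
  F n%:R - F (- n%:R) @[n --> \oo] --> 0 ->
  (\int[leb]_x (f x)%:E = 0)%E.
Proof.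
move=> dF cf intf cF.
have dvF x : derivable F x 1 by have [] := dF x.
have contF : continuous F.
  by move=> x; apply/differentiable_continuous/derivable1_diffP.
have cint := cvg_integral_symmetric_itv intf.
apply: (cvg_unique _ cint) => //.
have {}cF : (F n%:R - F (- n%:R))%:E @[n --> \oo] --> 0%E.
  by apply/cvg_EFin; [exact: nearW|exact: cF].
(* The index 0 is left out because the fundamental theorem is applied to a nondegenerate
   interval. *)
apply: cvg_trans cF; apply: near_eq_cvg; exists 1%N => // n /= n0.
apply/esym; rewrite EFinB; apply: continuous_FTC2.
- by rewrite (@lt_trans _ _ 0) ?oppr_lt0 ?ltr0n.
- exact: continuous_subspaceT.
- split=> //.
  + by apply: cvg_at_right_filter; exact: contF.
  + by apply: cvg_at_left_filter; exact: contF.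
- by move=> x _; rewrite derive1E; have [_ ->] := dF x.
Qed.

Lemma is_derive_normal_pdf01 x :
  is_derive x 1 (normal_pdf 0 1) (- x * normal_pdf 0 1 x).
Proof.
have -> : normal_pdf 0 1 =
    (fun y : R => normal_peak 1 * expR (- (y ^+ 2 / 2))).
  by apply/funext => y; rewrite normal_pdf01E.
apply: is_derive_eq; rewrite /GRing.scale /=.
by field.
Qed.

Lemma is_derive_sin_normal_pdf01 xi p x :
  is_derive x 1 (fun y => sin (xi * y + p) * normal_pdf 0 1 y)
    (xi * cos (xi * x + p) * normal_pdf 0 1 x
     - x * sin (xi * x + p) * normal_pdf 0 1 x).
Proof.
have dn := is_derive_normal_pdf01 x.
have ds : is_derive x 1 (fun y => sin (xi * y + p)) (cos (xi * x + p) * xi).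
  have dl : is_derive x 1 (fun y => xi * y + p) xi.
    by apply: is_derive_eq; rewrite /GRing.scale /=; ring.
  exact: (@is_derive1_comp _ sin (fun y => xi * y + p) _ _ _
    (is_derive_sin (xi * x + p)) dl).
apply: (is_derive_eq (is_deriveM ds dn)); by rewrite /GRing.scale /=; ring.
Qed.

Lemma is_derive_cos_normal_pdf01 p x xi :
  is_derive xi 1 (fun z => cos (z * x + p) * normal_pdf 0 1 x)
    (- (x * sin (xi * x + p)) * normal_pdf 0 1 x).
Proof.
have ds : is_derive xi 1 (fun z => cos (z * x + p)) (- sin (xi * x + p) * x).
  have dl : is_derive xi 1 (fun z => z * x + p) x.
    by apply: is_derive_eq; rewrite /GRing.scale /=; ring.
  exact: (@is_derive1_comp _ cos (fun z => z * x + p) _ _ _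
    (is_derive_cos (xi * x + p)) dl).
by apply: is_derive_eq; rewrite /GRing.scale /=; ring.
Qed.

Lemma cvg_normal_pdf01 (u : nat -> R) : (forall n, `|u n| = n%:R) ->
  normal_pdf 0 1 (u n) @[n --> \oo] --> 0.
Proof.
(* The constant comes from $u^2/2\ge|u|-1/2$, that is $(|u|-1)^2\ge0$. *)
move=> un; pose C : R := normal_peak 1 * expR 2^-1.
have cvgC : C * expR (- n%:R) @[n --> \oo] --> 0.
  rewrite -(mulr0 C); apply: cvgMl_tmp.
  exact: (cvg_comp _ _ cvgr_idn (@cvgr_expR R)).
apply: (squeeze_cvgr _ _ cvgC); last exact: cvg_cst.
apply: nearW => n; rewrite normal_pdf_ge0 normal_pdf01E /C -[leRHS]mulrA -expRD.

rewrite ler_wpM2l ?normal_peak_ge0// ler_expR.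
rewrite -[u n ^+ 2]real_normK ?num_real// un.
by have := sqr_ge0 (n%:R - 1 : R); lra.
Qed.

Lemma continuous_cos_affine xi p : continuous (fun x : R => cos (xi * x + p)).
Proof.
move=> x; apply: (@continuous_comp _ _ _ (fun y => xi * y + p) (@cos R)).
  by apply: cvgD; [apply: cvgMl_tmp; exact: cvg_id|exact: cvg_cst].
exact: continuous_cos.
Qed.

Lemma continuous_sin_affine xi p : continuous (fun x : R => sin (xi * x + p)).
Proof.
move=> x; apply: (@continuous_comp _ _ _ (fun y => xi * y + p) (@sin R)).
  by apply: cvgD; [apply: cvgMl_tmp; exact: cvg_id|exact: cvg_cst].
exact: continuous_sin.
Qed.

Lemma integrable_mul_sin_normal_pdf01 xi p :
  leb.-integrable setT
    (fun x => (x * sin (xi * x + p) * normal_pdf 0 1 x)%:E).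
Proof.
apply: le_integrable integrable_normr_normal_pdf01 => //.
- apply/measurable_EFinP/measurable_funM; last exact: measurable_normal_pdf.
  by apply: measurable_funM => //; exact: measurable_sin_affine.
- move=> x _; rewrite /= lee_fin 3!normrM normr_id.
  by rewrite ler_wpM2r// ler_piMr// sin_max.
Qed.

Lemma integrable_cos_normal_pdf01 xi p :
  leb.-integrable setT (fun x => (cos (xi * x + p) * normal_pdf 0 1 x)%:E).
Proof.
apply: integrable_bounded_normal_pdf; first exact: measurable_cos_affine.
by move=> x; exact: cos_max.
Qed.

(* Integration by parts, since the density satisfies g' = - x g. *)
Lemma Rintegral_mul_sin_normal_pdf01 xi p :
  \int[leb]_x (x * sin (xi * x + p) * normal_pdf 0 1 x) =
  xi * \int[leb]_x (cos (xi * x + p) * normal_pdf 0 1 x).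
Proof.
have ic := integrable_cos_normal_pdf01 xi p.
have isin := integrable_mul_sin_normal_pdf01 xi p.
have ic' : leb.-integrable setT
    (EFin \o (fun x => xi * (cos (xi * x + p) * normal_pdf 0 1 x))).
  exact: (integrableZl measurableT xi ic).
apply/esym/eqP; rewrite -subr_eq0 -RintegralZl// -RintegralB//.
rewrite /Rintegral; apply/eqP; rewrite (_ : integral _ _ _ = 0%E)//.
apply: (@integral_derivative_eq0
  (fun y => sin (xi * y + p) * normal_pdf 0 1 y)).
- move=> x; rewrite mulrA; exact: is_derive_sin_normal_pdf01.
- have cn : continuous (@normal_pdf R 0 1).
    by apply: continuous_normal_pdf; exact: oner_neq0.
  move=> x; apply: cvgB.
    apply: cvgMl_tmp; apply: cvgM; [exact: continuous_cos_affine|exact: cn].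
  apply: cvgM; last exact: cn.
  by apply: cvgM; [exact: cvg_id|exact: continuous_sin_affine].
- by have := integrableB measurableT ic' isin.
- have bnd (u : nat -> R) : (forall n, `|u n| = n%:R) ->
      sin (xi * u n + p) * normal_pdf 0 1 (u n) @[n --> \oo] --> 0.
    move=> /cvg_normal_pdf01 cu; apply: norm_cvg0.
    apply: (squeeze_cvgr _ _ cu); last exact: cvg_cst.
    apply: nearW => n; rewrite normr_ge0 normrM.
    rewrite (ger0_norm (normal_pdf_ge0 _ _ _)).
    by rewrite ler_piMl ?normal_pdf_ge0 ?sin_max.
  have b1 := bnd (fun n => n%:R) (fun n => ger0_norm (ler0n R n)).
  have b2 := bnd (fun n => - n%:R)
    (fun n => etrans (normrN _) (ger0_norm (ler0n R n))).
  by have := cvgB b1 b2; rewrite subr0; exact.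
Qed.

(** Differentiation under the integral sign, dominated by $|x|$ times the density for all
    frequencies at once; integration by parts then brings back the original integral. *)
Lemma is_derive_Rintegral_cos_normal_pdf01 xi p :
  is_derive xi 1 (fun z => \int[leb]_x (cos (z * x + p) * normal_pdf 0 1 x))
    (- xi * \int[leb]_x (cos (xi * x + p) * normal_pdf 0 1 x)).
Proof.
pose f z x := cos (z * x + p) * normal_pdf 0 1 x.
have d1E z x : partial1of2 f z x = - (x * sin (z * x + p)) * normal_pdf 0 1 x.
  by rewrite partial1of2E; have [_ ->] := is_derive_cos_normal_pdf01 p x z.
have Ixi : `](xi - 1), (xi + 1)[%classic xi.
  by rewrite /= in_itv/=; apply/andP; split; lra.
have intf z : `](xi - 1), (xi + 1)[%classic z ->
    leb.-integrable setT (EFin \o f z).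
  by move=> _; exact: integrable_cos_normal_pdf01.
have derf z y : `](xi - 1), (xi + 1)[%classic z -> setT y ->
    derivable (f ^~ y) z 1.
  by move=> _ _; have [] := is_derive_cos_normal_pdf01 p y z.
have G0 y : 0 <= `|y| * normal_pdf 0 1 y by rewrite mulr_ge0 ?normal_pdf_ge0.
have Gub z y : `](xi - 1), (xi + 1)[%classic z -> setT y ->
    `|partial1of2 f z y| <= `|y| * normal_pdf 0 1 y.
  move=> _ _; rewrite d1E normrM normrN normrM.
  rewrite (ger0_norm (normal_pdf_ge0 _ _ _)).
  by rewrite ler_wpM2r ?normal_pdf_ge0// ler_piMr// sin_max.
apply: DeriveDef.
  exact: (derivable_under_integral measurableT Ixi intf derf G0
    integrable_normr_normal_pdf01 Gub).
rewrite -derive1E (differentiation_under_integral measurableT Ixi intf derf G0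
    integrable_normr_normal_pdf01 Gub).
under eq_Rintegral do rewrite d1E mulNr -mulN1r.
rewrite RintegralZl//; last exact: integrable_mul_sin_normal_pdf01.
by rewrite Rintegral_mul_sin_normal_pdf01 mulN1r mulNr.
Qed.

(** The integral [F] solves $F'=-zF$, so $F(z)e^{z^2/2}$ is constant, and its value at 0 is $\cos
    p$. *)
Lemma Rintegral_cos_normal_pdf01 xi p :
  \int[leb]_x (cos (xi * x + p) * normal_pdf 0 1 x) =
  cos p * expR (- (xi ^+ 2 / 2)).
Proof.
pose F z := \int[leb]_x (cos (z * x + p) * normal_pdf 0 1 x).
pose E z : R := expR (z ^+ 2 / 2).
have dE (z : R) : is_derive z 1 E (z * E z).
  by rewrite /E; apply: is_derive_eq; rewrite /GRing.scale /=; field.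
have dF (z : R) : is_derive z 1 F (- z * F z).
  exact: is_derive_Rintegral_cos_normal_pdf01.
have dFE (z : R) : is_derive z 1 (fun z => F z * E z) 0.
  have dEz := dE z; have dFz := dF z.
  by apply: is_derive_eq; rewrite /GRing.scale /=; ring.
have := is_derive_0_is_cst xi 0 dFE.
have -> : F 0 = cos p.
  rewrite /F; under eq_Rintegral do rewrite mul0r add0r.
  rewrite RintegralZl//; last exact: integrable_normal_pdf.
  by rewrite /Rintegral integral_normal_pdf mulr1.
rewrite /E expr0n/= mul0r expR0 mulr1 => <-.
by rewrite expRN mulfK// gt_eqF// expR_gt0.
Qed.

Lemma Rintegral_cos_normal_prob01 xi p :
  \int[normal_prob 0 1]_x cos (xi * x + p) = cos p * expR (- (xi ^+ 2 / 2)).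
Proof.
rewrite -Rintegral_cos_normal_pdf01 /Rintegral integral_normal_prob//.
apply: measurable_bounded_integrable => //.
- by rewrite (le_lt_trans (probability_le1 _ _)) ?ltry.
- exact: measurable_cos_affine.
- exists 1; split => // M M1 x _ /=; apply: le_trans (ltW M1); exact: cos_max.
Qed.

End normal_characteristic_function.

(** * Gaussian smoothing and Levy's continuity theorem *)

Section bounded_integrals.
Context {R : realType} d (T : measurableType d) (P : probability T R).

Lemma integrable_normr_le (f : T -> R) (M : R) : measurable_fun setT f ->
  (forall x, `|f x| <= M) -> P.-integrable setT (EFin \o f).
Proof.
move=> mf fM; apply: measurable_bounded_integrable => //.
- by rewrite (le_lt_trans (probability_le1 _ _)) ?ltry.
- by exists M; split=> [|N MN x _]; [exact: num_real|exact: le_trans (ltW MN)].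
Qed.

Lemma Rintegral_probability_cst (M : R) : \int[P]_x M = M.
Proof.
rewrite Rintegral_cst// -[RHS]mulr1; congr (_ * _).
exact: (congr1 fine (probability_setT P)).
Qed.

Lemma integral_probability_cst (M : \bar R) : (\int[P]_x M = M)%E.
Proof.
rewrite integral_cst// -[RHS]mule1; congr (_ * _)%E.
exact: probability_setT.
Qed.

Lemma Rintegral_normr_le (f : T -> R) (M : R) : measurable_fun setT f ->
  (forall x, `|f x| <= M) -> `|\int[P]_x f x| <= M.
Proof.
move=> mf fM; have intf := integrable_normr_le mf fM.
apply: le_trans (le_normr_Rintegral measurableT intf) _.
rewrite (_ : M = \int[P]_x cst M x).
  apply: le_Rintegral => //; first exact: integrable_norm.
  apply: (@integrable_normr_le _ `|M|) => //.
by rewrite Rintegral_probability_cst.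
Qed.

Lemma cvg_Rintegral_bounded (f_ : nat -> T -> R) (f : T -> R) (M : R) :
  (forall n, measurable_fun setT (f_ n)) -> measurable_fun setT f ->
  (forall n x, `|f_ n x| <= M) ->
  (forall x, f_ n x @[n --> \oo] --> f x) ->
  \int[P]_x f_ n x @[n --> \oo] --> \int[P]_x f x.
Proof.
move=> mf_ mf fM cf.
have [] // := @dominated_convergence _ _ R P setT measurableT
  (fun n x => (f_ n x)%:E) (EFin \o f) (EFin \o cst M).
- by move=> n; exact/measurable_EFinP.
- exact/measurable_EFinP.
- by apply: aeW => x _; apply/cvg_EFin; [exact: nearW|exact: cf].
- by apply: (@integrable_normr_le _ `|M|).
- by apply: aeW => x n _; rewrite /= lee_fin.
move=> intf _ cint; apply: fine_cvg; rewrite fineK//.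
exact: integrable_fin_num.
Qed.

End bounded_integrals.

(** * Fubini's theorem for bounded functions on a product of probability spaces *)

Section bounded_fubini.
Context {R : realType} d1 d2 (T1 : measurableType d1) (T2 : measurableType d2).
Variables (P1 : probability T1 R) (P2 : probability T2 R).
Variables (f : T1 * T2 -> R) (M : R).
Hypotheses (mf : measurable_fun setT f) (fM : forall z, `|f z| <= M).

Let measurable_xsection x : measurable_fun setT (fun y => f (x, y)).
Proof. by apply: measurableT_comp => //; exact: pair1_measurable. Qed.

Let measurable_ysection y : measurable_fun setT (fun x => f (x, y)).
Proof. by apply: measurableT_comp => //; exact: pair2_measurable. Qed.

Lemma integrable_prod_bounded : (P1 \x P2)%E.-integrable setT (EFin \o f).
Proof.
(* Measurable types are pointed, so the bound is attained by some argument and [M] is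
   nonnegative. *)
have M0 : 0 <= M by apply: le_trans (fM point).
apply/integrable12ltyP; first exact/measurable_EFinP.
apply: (@le_lt_trans _ _ (\int[P1]_x \int[P2]_y M%:E)%E).
  apply: ge0_le_integral => //=.
  - by move=> x _; apply: integral_ge0 => y _; rewrite lee_fin.
  - apply: (measurable_fun_fubini_tonelli_F (fun z => `|f z|%:E)) => //.
    by apply/measurable_EFinP; apply: measurableT_comp.
  - move=> x _; apply: ge0_le_integral => //=.
    + by apply/measurable_EFinP; apply: measurableT_comp.
    + by move=> y _; rewrite lee_fin.
under eq_integral do rewrite integral_probability_cst.
by rewrite integral_probability_cst ltry.
Qed.

Lemma measurable_Rintegral_bounded :
  measurable_fun setT (fun x => \int[P2]_y f (x, y)).
Proof.
apply: (@measurableT_comp _ _ _ _ _ _ (@fine R)) => //.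
exact: (measurable_fubini_F integrable_prod_bounded).
Qed.

Lemma Rintegral_exchange :
  \int[P1]_x \int[P2]_y f (x, y) = \int[P2]_y \int[P1]_x f (x, y).
Proof.
rewrite /Rintegral; congr fine.
transitivity (\int[P1]_x \int[P2]_y (f (x, y))%:E)%E.
  apply: eq_integral => x _; rewrite fineK//.
  by apply: integrable_fin_num => //; exact: (@integrable_normr_le _ _ _ _ _ M).
rewrite (Fubini integrable_prod_bounded).
apply: eq_integral => y _; rewrite fineK//.
by apply: integrable_fin_num => //; exact: (@integrable_normr_le _ _ _ _ _ M).
Qed.

End bounded_fubini.

(** * Convolution with a centred Gaussian *)

Section gaussian_smoothing.
Context {R : realType}.
Local Notation leb := (@lebesgue_measure R).
Local Notation gauss := (@normal_prob R 0 1).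
Implicit Types (e x y u v : R) (P : probability (measurableTypeR R) R).

(** Up to scaling, the Gaussian is its own Fourier transform: the exponential factor of the density
    is the characteristic function of $N(0,1)$ at $(y-x)/e$. *)
Lemma normal_pdf_cosE e x y : e != 0 ->
  normal_pdf x e y = normal_peak e * \int[gauss]_z cos ((y - x) / e * z).
Proof.
move=> e0; under eq_Rintegral do rewrite -[_ * _]addr0.
rewrite Rintegral_cos_normal_prob01 cos0 mul1r normal_pdfE// /normal_fun.
congr (_ * expR _); rewrite -mulr_natl; field.
exact: e0.
Qed.

Lemma normal_pdf_sym e x y : e != 0 -> normal_pdf x e y = normal_pdf y e x.
Proof.
by move=> e0; rewrite !normal_pdfE// /normal_fun -(sqrrN (y - x)) opprB.
Qed.

Lemma measurable_fun_normal_pdf_mean e : e != 0 ->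
  measurable_fun setT (fun z : R * R => normal_pdf z.1 e z.2).
Proof.
move=> e0; under eq_fun do rewrite normal_pdfE//.
apply: measurable_funM => //; apply: measurableT_comp => //.
apply: measurable_funM => //; apply: measurableT_comp => //.
by apply: measurable_funX; apply: measurable_funB;
  [exact: measurable_snd|exact: measurable_fst].
Qed.

Lemma measurable_normal_pdf_mean e y : e != 0 ->
  measurable_fun setT (fun x : R => normal_pdf x e y).
Proof.
move=> e0; rewrite (_ : (fun x => _) = normal_pdf y e).
  exact: measurable_normal_pdf.
by apply/funext => x; rewrite normal_pdf_sym.
Qed.

(** The left side is the density at [y] of [P] convolved with $N(0,e^2)$. Fubini's theorem turns it
    into a Gaussian mixture of cosine integrals against [P], with frequency $-z/e$ and phase $yz/e$;
    the free phase is what lets [y] enter. *)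
Lemma Rintegral_normal_pdf_mean P e y : e != 0 ->
  \int[P]_x normal_pdf x e y =
  normal_peak e * \int[gauss]_z \int[P]_x cos (- (z / e) * x + y / e * z).
Proof.
move=> e0; under eq_Rintegral do rewrite normal_pdf_cosE//.
pose f (w : R * R) := cos ((y - w.1) / e * w.2).
have mf : measurable_fun setT f.
  apply: (@measurableT_comp _ _ _ _ _ _ (@cos R)).
    by apply: continuous_measurable_fun; exact: continuous_cos.
  apply: measurable_funM => //; apply: measurable_funM => //.
  exact: measurable_funB.
have f1 w : `|f w| <= 1 by exact: cos_max.
have := @Rintegral_exchange R _ _ _ _ P gauss f 1 mf f1.
rewrite /f /= RintegralZl//; last first.
  apply: (@integrable_normr_le _ _ _ _ _ 1) => [|x].
    rewrite (_ : (fun x => _) = fun x => (normal_peak e)^-1 * normal_pdf x e y).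
      by apply: measurable_funM => //; exact: measurable_normal_pdf_mean.
    apply/funext => x; rewrite normal_pdf_cosE// mulKf//.
    by rewrite gt_eqF// normal_peak_gt0.
  apply: Rintegral_normr_le => [|z]; last exact: cos_max.
  have := measurable_cos_affine ((y - x) / e) 0.
  by under eq_fun do rewrite addr0.
move=> ->; congr (_ * _).
by apply: eq_Rintegral => z _; apply: eq_Rintegral => x _; congr cos; field.
Qed.

(** In the mixture formula the cosine integrals converge for each [z] and are bounded by 1, so
    dominated convergence under the Gaussian law in [z] applies. *)
Lemma cvg_Rintegral_normal_pdf_mean
    (P_ : nat -> probability (measurableTypeR R) R) P e y : e != 0 ->
  (forall xi p, \int[P_ n]_x cos (xi * x + p) @[n --> \oo]
    --> \int[P]_x cos (xi * x + p)) ->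
  \int[P_ n]_x normal_pdf x e y @[n --> \oo] --> \int[P]_x normal_pdf x e y.
Proof.
move=> e0 cP; under eq_cvg do rewrite Rintegral_normal_pdf_mean//.
rewrite Rintegral_normal_pdf_mean//; apply: cvgMl_tmp.
have mz (Q : probability (measurableTypeR R) R) :
    measurable_fun setT
      (fun z : R => \int[Q]_x cos (- (z / e) * x + y / e * z)).
  pose f (w : R * R) := cos (- (w.1 / e) * w.2 + y / e * w.1).
  apply: (@measurable_Rintegral_bounded R _ _ _ _ gauss Q f 1).
    apply: (@measurableT_comp _ _ _ _ _ _ (@cos R)).
      by apply: continuous_measurable_fun; exact: continuous_cos.
    apply: measurable_funD; apply: measurable_funM => //.
    by apply: measurableT_comp => //; exact: measurable_funM.
  by move=> w; exact: cos_max.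
apply: (@cvg_Rintegral_bounded R _ _ gauss
  (fun n z => \int[P_ n]_x cos (- (z / e) * x + y / e * z))
  (fun z => \int[P]_x cos (- (z / e) * x + y / e * z)) 1).
- by move=> n; exact: mz.
- exact: mz.
- move=> n z; apply: Rintegral_normr_le => [|x]; last exact: cos_max.
  exact: measurable_cos_affine.
- by move=> z; exact: cP.
Qed.

(** A function of the mean and the point together, cut off outside [A] in the point, so that
    Tonelli's theorem applies on the whole product. *)
Let f e (A : set R) (z : R * R) : \bar R :=
  ((fun y : R => (normal_pdf z.1 e y)%:E) \_ A) z.2.

Let f_ge0 e A z : (0 <= f e A z)%E.
Proof. by rewrite /f patchE; case: ifP; rewrite ?lee_fin ?normal_pdf_ge0. Qed.

Let measurable_f e A : e != 0 -> measurable A -> measurable_fun setT (f e A).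
Proof.
move=> e0 mA.
rewrite (_ : f e A = fun z => ((normal_pdf z.1 e z.2 * \1_A z.2)%:E)).
  apply/measurable_EFinP; apply: measurable_funM.
    exact: measurable_fun_normal_pdf_mean.
  by apply: measurableT_comp => //; exact: measurable_indic.
apply/funext => z; rewrite /f patchE indicE.
by case: ifP => _; rewrite ?mulr1 ?mulr0.
Qed.

Lemma measurable_normal_prob_mean e (A : set R) : e != 0 -> measurable A ->
  measurable_fun setT (fun x : R => normal_prob x e A).
Proof.
move=> e0 mA; rewrite /normal_prob; under eq_fun do rewrite integral_mkcond.
exact: (@measurable_fun_fubini_tonelli_F _ _ _ _ _ leb (f e A)
  (measurable_f e0 mA) (f_ge0 e A)).
Qed.

(** Both sides are the mass of [A] under [P] convolved with $N(0,e^2)$; they differ by the order of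
    integration in Tonelli's theorem. *)
Lemma integral_normal_prob_mean P e (A : set R) : e != 0 -> measurable A ->
  (\int[P]_x normal_prob x e A =
   \int[leb]_(y in A) (\int[P]_x normal_pdf x e y)%R%:E)%E.
Proof.
move=> e0 mA; rewrite /normal_prob.
under eq_integral do rewrite integral_mkcond.
rewrite (@fubini_tonelli _ _ _ _ _ P leb (f e A) (measurable_f e0 mA)
  (f_ge0 e A)).
rewrite [RHS]integral_mkcond; apply: eq_integral => y _.
rewrite /f /=.
under eq_integral do rewrite patchE.
rewrite patchE; case: ifP => _; last exact: integral0.
rewrite /Rintegral fineK//; apply: integrable_fin_num => //.
apply: (@integrable_normr_le _ _ _ _ _ (normal_peak e)).
  exact: measurable_normal_pdf_mean.
by move=> x; rewrite ger0_norm ?normal_pdf_ge0 ?normal_pdf_ub.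
Qed.

End gaussian_smoothing.

(** * Probabilities as real numbers *)

Section fine_probability.
Context {R : realType} d (T : measurableType d) (P : probability T R).
Implicit Types A B C : set T.

Lemma fine_probabilityK A : measurable A -> ((fine (P A))%:E = P A)%E.
Proof. by move=> mA; rewrite fineK// fin_num_measure. Qed.

Lemma fine_probability_le1 A : measurable A -> fine (P A) <= 1.
Proof. by move=> mA; rewrite -lee_fin fine_probabilityK// probability_le1. Qed.

Lemma le_fine_probability A B : measurable A -> measurable B -> A `<=` B ->
  fine (P A) <= fine (P B).
Proof.
by move=> mA mB AB; rewrite -lee_fin !fine_probabilityK// le_measure ?inE.
Qed.

Lemma fine_probability_setC A : measurable A ->
  fine (P (~` A)) = 1 - fine (P A).
Proof.
move=> mA; apply: EFin_inj; rewrite EFinB !fine_probabilityK//.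
  exact: probability_setC.
exact: measurableC.
Qed.

Lemma fine_probability_subU A B C :
  measurable A -> measurable B -> measurable C ->
  A `<=` B `|` C -> fine (P A) <= fine (P B) + fine (P C).
Proof.
move=> mA mB mC AB; rewrite -lee_fin EFinD !fine_probabilityK//.
apply: le_trans (measureU2 _ mB mC).
by rewrite le_measure ?inE//; exact: measurableU.
Qed.

Lemma fine_probability_disjoint_le1 A B : measurable A -> measurable B ->
  A `&` B = set0 -> fine (P A) + fine (P B) <= 1.
Proof.
move=> mA mB AB0; rewrite -lee_fin EFinD !fine_probabilityK//.
rewrite -measureU//; apply: probability_le1; exact: measurableU.
Qed.

Lemma Rintegral_indic A : measurable A -> \int[P]_x \1_A x = fine (P A).
Proof. by move=> mA; rewrite /Rintegral integral_indic// setIT. Qed.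

End fine_probability.

(** * From smoothed laws to distribution functions *)

Section levy_continuity.
Context {R : realType}.
Local Notation leb := (@lebesgue_measure R).
Implicit Types (e x y u v h a b : R) (P : probability (measurableTypeR R) R).

(** The smoothed densities converge pointwise and are bounded by the peak height, a constant that is
    integrable on the compact interval; dominated convergence applies. *)
Lemma cvg_Rintegral_normal_prob_mean
    (P_ : nat -> probability (measurableTypeR R) R) P e u v : e != 0 ->
  (forall xi p, \int[P_ n]_x cos (xi * x + p) @[n --> \oo]
    --> \int[P]_x cos (xi * x + p)) ->
  (\int[P_ n]_x normal_prob x e `[u, v])%E @[n --> \oo] -->
  (\int[P]_x normal_prob x e `[u, v])%E.
Proof.
move=> e0 cP.
under eq_cvg do rewrite integral_normal_prob_mean//.
rewrite integral_normal_prob_mean//.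
have mk (Q : probability (measurableTypeR R) R) :
    measurable_fun setT (fun y => (\int[Q]_x normal_pdf x e y)%R%:E).
  apply/measurable_EFinP.
  pose f (w : R * R) := normal_pdf w.2 e w.1.
  (* The standard normal law serves as the first factor of the bounded Fubini setting; what is
     extracted is measurability in [y]. *)
  apply: (@measurable_Rintegral_bounded R _ _ _ _ (normal_prob 0 1) Q f
    (normal_peak e)).
    rewrite (_ : f = fun w => normal_pdf w.1 e w.2).
      exact: measurable_fun_normal_pdf_mean.
    by apply/funext => w; rewrite /f normal_pdf_sym.
  by move=> w; rewrite ger0_norm ?normal_pdf_ge0 ?normal_pdf_ub.
have [] // := @dominated_convergence _ _ R leb `[u, v] (measurable_itv _)
  (fun n y => (\int[P_ n]_x normal_pdf x e y)%R%:E)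
  (fun y => (\int[P]_x normal_pdf x e y)%R%:E) (EFin \o cst (normal_peak e)).
- by move=> n; apply: measurable_funTS; exact: mk.
- by apply: measurable_funTS; exact: mk.
- apply: aeW => y _; apply/cvg_EFin; first exact: nearW.
  exact: cvg_Rintegral_normal_pdf_mean.
- apply: continuous_compact_integrable; first exact: segment_compact.
  by apply: continuous_subspaceT => y; exact: cvg_cst.
- apply: aeW => y n _; rewrite /= lee_fin.
  apply: Rintegral_normr_le; first exact: measurable_normal_pdf_mean.
  by move=> x; rewrite ger0_norm ?normal_pdf_ge0 ?normal_pdf_ub.
Qed.

(** When [x] lies outside the enlarged interval, all of $[u,v]$ is at distance at least [h] from
    [x], so its mass is a Gaussian tail. *)
Lemma fine_normal_prob_itv_le e u v h x : e != 0 -> 0 <= h ->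
  fine (normal_prob x e `[u, v]) <=
  \1_`[u - h, v + h] x + Num.sqrt 2 * expR (- (h ^+ 2 / (4 * e ^+ 2))).
Proof.
move=> e0 h0; rewrite indicE; have [_|xuv] := boolP (x \in _).
  have := fine_probability_le1 (normal_prob x e) (measurable_itv `[u, v]).
  move=> /le_trans; apply.
  by rewrite lerDl mulr_ge0 ?sqrtr_ge0 ?expR_ge0.
rewrite add0r -lee_fin fine_probabilityK//.
apply: le_trans (normal_prob_tail_le x e0 h0).
have mA := measurable_normr_sub_ge x h.
rewrite le_measure ?inE// => y /=; rewrite in_itv/= => /andP[uy yv].
move: xuv; rewrite notin_setE/= in_itv/= => /negP; rewrite negb_and -!ltNge.
by rewrite ler_normr => /orP[xu|vx]; apply/orP; [left|right]; lra.
Qed.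

(** When [x] lies in the shrunk interval, the complement of $[u,v]$ is at distance at least [h] from
    [x], so what is missing is a Gaussian tail. *)
Lemma fine_normal_prob_itv_ge e u v h x : e != 0 -> 0 <= h ->
  \1_`[u + h, v - h] x - Num.sqrt 2 * expR (- (h ^+ 2 / (4 * e ^+ 2))) <=
  fine (normal_prob x e `[u, v]).
Proof.
move=> e0 h0; rewrite indicE; have [xuv|_] := boolP (x \in _); last first.
  apply: (@le_trans _ _ 0); last by rewrite fine_ge0.
  by rewrite sub0r oppr_le0 mulr_ge0 ?sqrtr_ge0 ?expR_ge0.
rewrite lerBlDr -lerBlDl.
rewrite -(fine_probability_setC (normal_prob x e) (measurable_itv `[u, v])).
rewrite -lee_fin fine_probabilityK; last exact: measurableC.
apply: le_trans (normal_prob_tail_le x e0 h0).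
have mA := measurable_normr_sub_ge x h.
rewrite le_measure ?inE//; first exact: measurableC.
move=> y /=; rewrite in_itv/= => /negP; rewrite negb_and -!ltNge.
move: xuv; rewrite inE/= in_itv/= => /andP[ux xv].
by rewrite ler_normr => /orP[yu|vy]; apply/orP; [right|left]; lra.
Qed.

(** The mass of $[u,v]$ under the convolution of [P] with $N(0,e^2)$, as a real number. *)
Let blur P e u v := \int[P]_x fine (normal_prob x e `[u, v]).

Let measurable_blur e u v : e != 0 ->
  measurable_fun setT (fun x => fine (normal_prob x e `[u, v])).
Proof.
move=> e0; apply: (@measurableT_comp _ _ _ _ _ _ (@fine R)) => //.
exact: measurable_normal_prob_mean.
Qed.

Let blur_le1 e u v x : `|fine (normal_prob x e `[u, v])| <= 1.
Proof. by rewrite ger0_norm ?fine_ge0// fine_probability_le1. Qed.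

Let integrable_blur P e u v : e != 0 ->
  P.-integrable setT (fun x => (fine (normal_prob x e `[u, v]))%:E).
Proof.
move=> e0.
exact: (@integrable_normr_le R _ _ P _ 1 (measurable_blur u v e0)
  (@blur_le1 e u v)).
Qed.

Let integrable_itv P u v :
  P.-integrable setT (fun x => (\1_(`[u, v]%classic : set R) x)%:E).
Proof.
apply: (@integrable_normr_le _ _ _ _ _ 1); first exact: measurable_indic.
by move=> x; rewrite indicE; case: (_ \in _); rewrite ?normr1 ?normr0.
Qed.

Let integrable_const P (k : R) : P.-integrable setT (EFin \o cst k).
Proof. by apply: (@integrable_normr_le _ _ _ _ _ `|k|). Qed.

Let blur_le P e u v h : e != 0 -> 0 <= h ->
  blur P e u v <= fine (P `[u - h, v + h]%classic) +
    Num.sqrt 2 * expR (- (h ^+ 2 / (4 * e ^+ 2))).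
Proof.
move=> e0 h0; set k := _ * expR _.
rewrite -Rintegral_indic// -(Rintegral_probability_cst P k) -RintegralD//.
- apply: le_Rintegral => //; first exact: integrable_blur.
    exact: (integrableD measurableT (integrable_itv P _ _)
      (integrable_const P k)).
  by move=> x _; exact: fine_normal_prob_itv_le.
- exact: integrable_itv.
- exact: integrable_const.
Qed.

Let blur_ge P e u v h : e != 0 -> 0 <= h ->
  fine (P `[u + h, v - h]%classic) -
    Num.sqrt 2 * expR (- (h ^+ 2 / (4 * e ^+ 2))) <= blur P e u v.
Proof.
move=> e0 h0; set k := _ * expR _.
rewrite -Rintegral_indic// -(Rintegral_probability_cst P k) -RintegralB//.
- apply: le_Rintegral => //; last 2 first.
    exact: integrable_blur.
    by move=> x _; exact: fine_normal_prob_itv_ge.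
  exact: (integrableB measurableT (integrable_itv P _ _)
    (integrable_const P k)).
- exact: integrable_itv.
- exact: integrable_const.
Qed.

Let cvg_blur (P_ : nat -> probability (measurableTypeR R) R) P e u v : e != 0 ->
  (forall xi p, \int[P_ n]_x cos (xi * x + p) @[n --> \oo]
    --> \int[P]_x cos (xi * x + p)) ->
  blur (P_ n) e u v @[n --> \oo] --> blur P e u v.
Proof.
move=> e0 cP.
have blurE (Q : probability (measurableTypeR R) R) :
    (\int[Q]_x normal_prob x e `[u, v] = (blur Q e u v)%:E)%E.
  rewrite /blur /Rintegral fineK.
    by apply: eq_integral => x _; rewrite fine_probabilityK.
  by apply: integrable_fin_num => //; exact: integrable_blur.
have := @cvg_Rintegral_normal_prob_mean P_ P e u v e0 cP.
by rewrite blurE; under eq_cvg do rewrite blurE; move=> /fine_cvg.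
Qed.

Let small_tail h k : 0 < h -> 0 < k ->
  exists2 e, e != 0 & Num.sqrt 2 * expR (- (h ^+ 2 / (4 * e ^+ 2))) <= k.
Proof.
(* With this [e] the exponent is $-2/k$, and $\sqrt2\,e^{-2/k}\le 2/(1+2/k)\le k$. *)
move=> h0 k0; exists (h * Num.sqrt (k / 8)).
  by rewrite mulf_neq0 ?gt_eqF// sqrtr_gt0 divr_gt0.
rewrite exprMn sqr_sqrtr; last by rewrite divr_ge0// ltW.
have -> : h ^+ 2 / (4 * (h ^+ 2 * (k / 8))) = 2 / k.
  by field; rewrite !gt_eqF.
have s2 : Num.sqrt 2 <= 2 :> R.
  by rewrite -[leRHS]ger0_norm// -sqrtr_sqr ler_sqrt//; lra.
rewrite (le_trans (ler_wpM2r (expR_ge0 _) s2))// expRN ler_pdivrMr ?expR_gt0//.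
apply: (@le_trans _ _ (k * (1 + 2 / k))); last by rewrite ler_pM2l ?expR_ge1Dx.
by rewrite mulrDr mulr1 mulrCA divff ?gt_eqF//; lra.
Qed.

(** Seen as a random variable under [P], the identity has law [P], which gives access to the limits
    of distribution functions at both infinities. *)
Let idR : measurableTypeR R -> R := idfun.

#[local] HB.instance Definition _ :=
  @isMeasurableFun.Build _ _ _ _ idR (@measurable_id _ _ setT).

Let probability_itvNy_small P k : 0 < k ->
  exists x, fine (P `]-oo, x]%classic) <= k.
Proof.
move=> k0.
have /fine_cvgP[_] := @cvg_cdfNy0 _ _ R P (idR : {RV P >-> R}).
(* Neighbourhoods of $-\infty$ are described by a strict inequality, so a point strictly below [A]
   is chosen. *)
move=> /cvgrPdist_le /(_ _ k0)[A [_ HA]]; exists (A - 1).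
have /= := HA (A - 1); rewrite gtrBl ltr01 => /(_ isT).
by rewrite sub0r normrN; apply: le_trans; exact: ler_norm.
Qed.

Let probability_itvNy_large P k : 0 < k ->
  exists x, 1 - k <= fine (P `]-oo, x]%classic).
Proof.
move=> k0.
have /fine_cvgP[_] := @cvg_cdfy1 _ _ R P (idR : {RV P >-> R}).
move=> /cvgrPdist_le /(_ _ k0)[A [_ HA]]; exists (A + 1).
have /= := HA (A + 1); rewrite ltrDl ltr01 => /(_ isT).
by rewrite lerBlDr -lerBlDl; apply: le_trans; exact: ler_norm.
Qed.

(* The lower half of the portmanteau theorem, with enlarged intervals. *)
Lemma near_fine_probability_itv_ge
    (P_ : nat -> probability (measurableTypeR R) R) P a b h k :
  0 < h -> 0 < k ->
  (forall xi p, \int[P_ n]_x cos (xi * x + p) @[n --> \oo]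
    --> \int[P]_x cos (xi * x + p)) ->
  \forall n \near \oo,
    fine (P `[a, b]%classic) - k <= fine (P_ n `[a - h, b + h]%classic).
Proof.
move=> h0 k0 cP.
have h20 : 0 < h / 2 by rewrite divr_gt0.
(* The error [k] is shared by two Gaussian tails and the distance between the two smoothed masses.
   The margin [h] is shared by the passage from [P] to its smoothing and the passage back from the
   smoothing of [P_ n]. *)
have [e e0 ek] := small_tail h20 (divr_gt0 k0 (ltr0n R 3)).
have cb := @cvg_blur P_ P e (a - h / 2) (b + h / 2) e0 cP.
have hP := @blur_ge P e (a - h / 2) (b + h / 2) (h / 2) e0 (ltW h20).
rewrite subrK addrK in hP.
near=> n.
have hn := @blur_le (P_ n) e (a - h / 2) (b + h / 2) (h / 2) e0 (ltW h20).
have := hn; rewrite -addrA -opprD -splitr -addrA -splitr => {}hn.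
have : `|blur P e (a - h / 2) (b + h / 2)
         - blur (P_ n) e (a - h / 2) (b + h / 2)| <= k / 3.
  by near: n; move/cvgrPdist_le : cb; apply; rewrite divr_gt0.
rewrite ler_norml => /andP[_].
move: hn hP ek; set t := _ * expR _; lra.
Unshelve. all: end_near. Qed.

(** A bounded interval to the left of [x] bounds the distribution function from below; one to the
    right of [x] bounds it from above, because the total mass is 1. Each bound loses three times
    $k/3$: to the convergence on intervals, to the truncation at [A] or [B], and to the continuity
    of the limit at [x]. *)
Theorem levy_continuity (P_ : nat -> probability (measurableTypeR R) R) P x :
  (forall xi p, \int[P_ n]_x cos (xi * x + p) @[n --> \oo]
    --> \int[P]_x cos (xi * x + p)) ->
  {for x, continuous (fun y : R => P `]-oo, y]%classic)} ->
  P_ n `]-oo, x]%classic @[n --> \oo] --> P `]-oo, x]%classic.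
Proof.
move=> cP cx.
pose F (Q : probability (measurableTypeR R) R) y := fine (Q `]-oo, y]%classic).
have FK Q y : (F Q y)%:E = Q `]-oo, y]%classic by exact: fine_probabilityK.
have cF : F P y @[y --> x] --> F P x.
  by apply: fine_cvg; rewrite FK; exact: cx.
rewrite -FK; under eq_cvg do rewrite -FK.
apply/cvg_EFin; first exact: nearW.
apply/cvgrPdist_le => k k0.
pose k3 := k / 3; have k30 : 0 < k3 by rewrite divr_gt0.
have [h h0 hF] : exists2 h : R, 0 < h &
    forall y, `|y - x| <= h -> `|F P y - F P x| <= k3.
  move/cvgrPdist_le : cF => /(_ _ k30)[/= r r0 hr].
  exists (r / 2); first by rewrite divr_gt0.
  move=> y yx; rewrite distrC; apply: hr; rewrite /= distrC.
  by rewrite (le_lt_trans yx)// ltr_pdivrMr// ltr_pMr// ltr1n.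
have [A FA] : exists A, F P A <= k3 := probability_itvNy_small P k30.
have [B FB] : exists B, 1 - k3 <= F P B := probability_itvNy_large P k30.
have h20 : 0 < h / 2 by rewrite divr_gt0.
near=> n.
rewrite /= distrC ler_distl; apply/andP; split.
(* Stopping at $x-h/2$ makes the interval enlarged by $h/2$ end exactly at [x]. *)
- have h1 : fine (P `[A, x - h / 2]%classic) - k3 <= F (P_ n) x.
    apply: (@le_trans _ _
      (fine (P_ n `[A - h / 2, x - h / 2 + h / 2]%classic))).
      by near: n; exact: near_fine_probability_itv_ge.
    apply: le_fine_probability => // y /=.
    by rewrite !in_itv/= subrK => /andP[].
  have h2 : F P (x - h / 2) <= F P A + fine (P `[A, x - h / 2]%classic).
    apply: fine_probability_subU => // y /=; rewrite !in_itv/= => yx.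
    by have [yA|/ltW Ay] := leP y A; [left|right; rewrite Ay].
  have := hF (x - h / 2); rewrite addrAC subrr sub0r normrN gtr0_norm//.
  rewrite ler_norml => /(_ ltac:(lra))/andP[h3 _].
  by rewrite /k3 in h1 h3 FA; lra.
(* Starting at $x+h$ keeps the interval enlarged by $h/2$ strictly to the right of [x], hence
   disjoint from the half-line. *)
- have h1 : fine (P `[x + h, B]%classic) - k3 <=
      fine (P_ n `[x + h / 2, B + h / 2]%classic).
    have -> : x + h / 2 = x + h - h / 2 by lra.
    by near: n; exact: near_fine_probability_itv_ge.
  have h2 : F P B <= F P (x + h) + fine (P `[x + h, B]%classic).
    apply: fine_probability_subU => // y /=; rewrite !in_itv/= => yx.
    by have [yA|/ltW Ay] := leP y (x + h); [left|right; rewrite Ay].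
  have h4 : F (P_ n) x + fine (P_ n `[x + h / 2, B + h / 2]%classic) <= 1.
    apply: fine_probability_disjoint_le1 => //.
    apply/seteqP; split=> // y /= []; rewrite !in_itv/= => yx /andP[xy _].
    by move: (le_trans xy yx); rewrite gerDl leNgt h20.
  have := hF (x + h); rewrite addrAC subrr add0r gtr0_norm//.
  rewrite lexx ler_norml => /(_ isT)/andP[_ h3].
  by rewrite /k3 in h1 h3 FB; lra.
Unshelve. all: end_near. Qed.

End levy_continuity.

(** * The Variance-Gamma characteristic function *)

Section complex_functions.
Context {R : realType}.
Implicit Types (z w : R[i]) (x y : R).

Lemma cexpD z w : cexp (z + w) = cexp z * cexp w.
Proof.
case: z w => [a b] [c d]; rewrite /cexp /= expRD cosD sinD.
by apply/eqP; rewrite eq_complex /=; apply/andP; split; apply/eqP; ring.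
Qed.

Lemma cexp_neq0 z : cexp z != 0.
Proof.
apply/eqP => z0; have := cexpD z (- z).
rewrite subrr z0 mul0r /cexp /= cos0 sin0 expR0 mulr1 => /eqP.
by rewrite eq_complex /= oner_eq0.
Qed.

Lemma cexpB z w : cexp (z - w) = cexp z / cexp w.
Proof. by apply: (canRL (mulfK (cexp_neq0 w))); rewrite -cexpD subrK. Qed.

(** For $y\ge0$ the cosine of $\arctan(y/x)$ is $x/\sqrt{x^2+y^2}$, and this angle lies in the range
    where [acos] inverts the cosine. Negative [y] follows by oddness. *)
Lemma carg_atan x y : 0 < x -> carg (x +i* y)%C = atan (y / x).
Proof.
have acosE x' y' : 0 < x' -> 0 <= y' ->
    acos (x' / Num.sqrt (x' ^+ 2 + y' ^+ 2)) = atan (y' / x').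
  move=> x0 y0.
  have -> : x' / Num.sqrt (x' ^+ 2 + y' ^+ 2) = cos (atan (y' / x')).
    have xy0 : 0 <= x' ^+ 2 + y' ^+ 2 by rewrite addr_ge0 ?sqr_ge0.
    rewrite cos_atan (_ : 1 + _ = (x' ^+ 2 + y' ^+ 2) * x'^-1 ^+ 2); last first.
      by field; rewrite gt_eqF.
    by rewrite sqrtrM// sqrtr_sqr gtr0_norm ?invr_gt0// invfM invrK mulrC.
  rewrite cosK// in_itv/=; apply/andP; split.
    by rewrite -atan0; apply: le_atan; rewrite divr_ge0// ltW.
  rewrite (le_trans (ltW (atan_ltpi2 _)))// ler_pdivrMr// ler_peMr ?pi_ge0//.
  by rewrite ler1n.
move=> x0; rewrite /carg /=; have [y0|y0] := leP 0 y; first exact: acosE.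
by rewrite -(sqrrN y) acosE ?oppr_ge0 ?(ltW y0)// mulNr atanN opprK.
Qed.

(** By oddness one may take $y\ge0$. The mean value theorem gives $\arctan y=y/(1+c^2)$ with [c]
    between 0 and [y], so the difference has absolute value $yc^2/(1+c^2)\le y^3$. *)
Lemma atan_sub_id_le y : `|atan y - y| <= `|y| ^+ 3.
Proof.
wlog y0 : y / 0 <= y.
  move=> H; have [|/ltW y0] := leP 0 y; first exact: H.
  have := H (- y); rewrite oppr_ge0 atanN normrN -opprD normrN; exact.
have dA x : x \in `]0, y[ -> is_derive x 1 (@atan R) (1 + x ^+ 2)^-1.
  by move=> _; exact: is_derive1_atan.
have cA : {within `[0, y], continuous (@atan R)}.
  by apply: continuous_subspaceT => x; exact: continuous_atan.
have [c] := MVT_segment y0 dA cA.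
rewrite in_itv/= atan0 !subr0 => /andP[c0 cy] ->.
rewrite [`|y|]ger0_norm//.
have c20 : 0 < 1 + c ^+ 2 by rewrite ltr_pwDl ?sqr_ge0.
have -> : (1 + c ^+ 2)^-1 * y - y = - (y * (c ^+ 2 / (1 + c ^+ 2))).
  by field; rewrite gt_eqF.
rewrite normrN ger0_norm; last first.
  by rewrite mulr_ge0// divr_ge0 ?sqr_ge0// ltW.
rewrite exprS ler_wpM2l// ler_pdivrMr//.
have cy2 : c ^+ 2 <= y ^+ 2 by rewrite lerXn2r// nnegrE (le_trans c0).
by rewrite (le_trans cy2)// ler_peMr ?sqr_ge0// lerDl sqr_ge0.
Qed.

Lemma ln_sqrt x : 0 < x -> ln (Num.sqrt x) = ln x / 2.
Proof.
move=> x0; have s0 : 0 < Num.sqrt x by rewrite sqrtr_gt0.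
rewrite -[in RHS](sqr_sqrtr (ltW x0)) expr2 lnM ?posrE//.
by field.
Qed.

End complex_functions.

(** * Cosine integrals with a phase, from the characteristic function *)

Section characteristic_function.
Context {R : realType} d (T : measurableType d) (P : probability T R).

Lemma char_funE (X : {RV P >-> R}) (s : R) :
  char_fun X s = ((\int[P]_w cos (s * X w)) +i* (\int[P]_w sin (s * X w)))%C.
Proof.
rewrite /char_fun /cexpectation expectation.unlock /Rintegral /=.
congr (_ +i* _)%C; congr fine; apply: eq_integral => w _; congr EFin.
- by rewrite /= !(mul0r, mul1r, oppr0, add0r) expR0 mul1r.
- by rewrite /= !(mul0r, mul1r, oppr0, add0r) expR0 mul1r.
Qed.

(** The real and imaginary parts of the characteristic function, in polar form, are recombined by
    the addition formula for the cosine. *)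
Lemma Rintegral_cos_char_fun (X : {RV P >-> R}) (s q l a : R) :
  char_fun X s = cexp (l +i* a)%C ->
  \int[P]_w cos (s * X w + q) = expR l * cos (a + q).
Proof.
rewrite char_funE /cexp /= => -[Ec Es].
have mX : measurable_fun setT (fun w => s * X w) by exact: measurable_funM.
have ic : P.-integrable setT (EFin \o (fun w => cos q * cos (s * X w))).
  apply: (@integrable_normr_le _ _ _ _ _ 1).
    apply: measurable_funM => //.
    apply: (@measurableT_comp _ _ _ _ _ _ (@cos R)) => //.
    by apply: continuous_measurable_fun; exact: continuous_cos.
  by move=> w; rewrite normrM mulr_ile1// cos_max.
have is' : P.-integrable setT (EFin \o (fun w => sin q * sin (s * X w))).
  apply: (@integrable_normr_le _ _ _ _ _ 1).
    apply: measurable_funM => //.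
    apply: (@measurableT_comp _ _ _ _ _ _ (@sin R)) => //.
    by apply: continuous_measurable_fun; exact: continuous_sin.
  by move=> w; rewrite normrM mulr_ile1// sin_max.
transitivity (\int[P]_w (cos q * cos (s * X w) - sin q * sin (s * X w))).
  by apply: eq_Rintegral => w _; rewrite addrC cosD.
rewrite RintegralB//.
have ic1 : P.-integrable setT (EFin \o (fun w => cos (s * X w))).
  apply: (@integrable_normr_le _ _ _ _ _ 1); last by move=> w; exact: cos_max.
  apply: (@measurableT_comp _ _ _ _ _ _ (@cos R)) => //.
  by apply: continuous_measurable_fun; exact: continuous_cos.
have is1 : P.-integrable setT (EFin \o (fun w => sin (s * X w))).
  apply: (@integrable_normr_le _ _ _ _ _ 1); last by move=> w; exact: sin_max.
  apply: (@measurableT_comp _ _ _ _ _ _ (@sin R)) => //.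
  by apply: continuous_measurable_fun; exact: continuous_sin.
by rewrite !RintegralZl// Ec Es cosD; ring.
Qed.

End characteristic_function.

(** * Polar form of the Variance-Gamma characteristic function *)

Section variance_gamma.
Context {R : realType} d (T : measurableType d) (P : probability T R).
Variables (mu delta sigma alpha theta : R) (Y : R -> {RV P >-> R}).
Hypotheses (theta0 : 0 < theta).
Hypothesis hY : VG_Levy_process mu delta sigma alpha theta Y.

(** The base of the power has the form $x-iy$ with $x>0$, so its principal logarithm is
    $\frac12\ln(x^2+y^2)-i\arctan(y/x)$; this is multiplied by $-t\alpha$ and added to the drift
    exponent. *)
Lemma VG_char_fun t s : 0 <= t ->
  char_fun (Y t) s =
  cexp ((- (t * alpha * (ln ((1 + sigma ^+ 2 * theta / 2 * s ^+ 2) ^+ 2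
                             + (delta * theta * s) ^+ 2) / 2)))
    +i* (t * mu * s + t * alpha *
         atan (delta * theta * s / (1 + sigma ^+ 2 * theta / 2 * s ^+ 2))))%C.
Proof.
move=> t0; have [_ /(_ t s t0) ->] := hY.
pose x := 1 + sigma ^+ 2 * theta / 2 * s ^+ 2; pose y := delta * theta * s.
rewrite -/x -/y.
have x0 : 0 < x.
  by rewrite ltr_pwDl// mulr_ge0 ?sqr_ge0// divr_ge0// mulr_ge0 ?sqr_ge0 ?ltW.
rewrite (_ : 1 - _ + _ = (x +i* - y)%C); last first.
  apply/eqP; rewrite eq_complex /= /x /y; apply/andP; split; apply/eqP.
    by field.
  by ring.
rewrite /cpow -cexpB; congr cexp.
rewrite /clog carg_atan// mulNr atanN /= sqrrN ln_sqrt; last first.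
  by rewrite ltr_wpDr ?sqr_ge0// exprn_gt0.
by apply/eqP; rewrite eq_complex /=; apply/andP; split; apply/eqP; ring.
Qed.

End variance_gamma.

(** * Limits as time tends to infinity *)

Section limits_at_infinity.
Context {R : realType}.
Implicit Types (t l : R) (x : R -> R).

Lemma cvg_invr_pinfty : t^-1 @[t --> +oo%R] --> (0 : R).
Proof.
apply/gtr0_cvgV0; last exact: cvg_id.
by near=> t; near: t; exact: nbhs_pinfty_gt.
Unshelve. all: end_near. Qed.

Lemma cvg_invr_sqrt_pinfty : (Num.sqrt t)^-1 @[t --> +oo%R] --> (0 : R).
Proof.
have sq0 : Num.sqrt t^-1 @[t --> +oo%R] --> (0 : R).
  rewrite -[X in _ --> X]sqrtr0.
  exact: (cvg_comp _ _ cvg_invr_pinfty (@sqrt_continuous R 0)).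
apply: cvg_trans sq0; apply: near_eq_cvg; near=> t.
by rewrite sqrtrV//; near: t; exact: nbhs_pinfty_ge.
Unshelve. all: end_near. Qed.

(** This is $\ln(1+u)\le u$ at $u=-y/(1+y)$, for which $1+u=(1+y)^{-1}$. *)
Lemma ln1D_ge (y : R) : 0 <= y -> y / (1 + y) <= ln (1 + y).
Proof.
move=> y0; have y1 : 0 < 1 + y by rewrite ltr_pwDl.
rewrite -lerN2 -lnV ?posrE//.
rewrite [X in ln X](_ : _ = 1 + - (y / (1 + y))); last first.
  by field; rewrite gt_eqF.
apply: le_ln1Dx.
by rewrite ltrN2 ltr_pdivrMr// mul1r ltrDr ltr01.
Qed.

(** Squeezed between $tx/(1+x)$ and $tx$, where $x=t^{-1}(tx)$ tends to 0. *)
Lemma cvg_mul_ln1D x l : (forall t, 0 < t -> 0 <= x t) ->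
  t * x t @[t --> +oo%R] --> l -> t * ln (1 + x t) @[t --> +oo%R] --> l.
Proof.
move=> x0 cx.
have cx0 : x t @[t --> +oo%R] --> 0.
  have cx1 : t^-1 * (t * x t) @[t --> +oo%R] --> 0.
    rewrite -[X in _ --> X](mul0r l).
    by apply: cvgM; [exact: cvg_invr_pinfty|exact: cx].
  apply: cvg_trans cx1; apply: near_eq_cvg; near=> t.
  have t0 : 0 < t by near: t; exact: nbhs_pinfty_gt.
  by rewrite mulKf// gt_eqF.
have cl : t * x t / (1 + x t) @[t --> +oo%R] --> l.
  have c1 : 1 + x t @[t --> +oo%R] --> (1 : R).
    by rewrite -[X in _ --> X]addr0; apply: cvgD => //; exact: cvg_cst.
  rewrite -[X in _ --> X]divr1.
  by apply: cvgM => //; apply: cvgV => //; exact: oner_neq0.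
apply: (squeeze_cvgr _ cl cx); near=> t.
have t0 : 0 < t by near: t; exact: nbhs_pinfty_gt.
have xt0 := x0 t t0.
rewrite -mulrA !ler_pM2l// ln1D_ge// le_ln1Dx//.
by rewrite (lt_le_trans _ xt0)// ltrN10.
Unshelve. all: end_near. Qed.

End limits_at_infinity.

(** * Asymptotics of the modulus and the phase *)

Section VG_limit.
Context {R : realType}.
Implicit Types (t s xi p : R).

Lemma VG_phase_le (k g s : R) : 0 <= k ->
  `|atan (g * s / (1 + k * s ^+ 2)) - g * s|
    <= (`|g| ^+ 3 + `|g| * k) * `|s| ^+ 3.
Proof.
move=> k0; set q := 1 + k * s ^+ 2.
have q1 : 1 <= q by rewrite lerDl mulr_ge0 ?sqr_ge0.
have q0 : 0 < q by rewrite (lt_le_trans ltr01).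
have h1 : `|g * s / q| <= `|g * s|.
  by rewrite normrM normfV (gtr0_norm q0) ler_pdivrMr// ler_peMr.
(* The first difference is cubic by the arctangent estimate; the second, the cost of dropping the
   denominator [q], carries an explicit factor $s^3$. *)
have -> : atan (g * s / q) - g * s =
    (atan (g * s / q) - g * s / q) - g * s * (k * s ^+ 2 / q).
  by rewrite /q; field; rewrite gt_eqF.
rewrite (le_trans (ler_normB _ _))// mulrDl; apply: lerD.
  rewrite (le_trans (atan_sub_id_le _))// -exprMn -normrM.
  by rewrite lerXn2r// nnegrE.
have -> : `|g * s * (k * s ^+ 2 / q)| = `|g| * (k * `|s| ^+ 3 / q).
  by rewrite !normrM normfV (gtr0_norm q0) (ger0_norm k0); ring.
rewrite -[leRHS]mulrA ler_wpM2l//.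
by rewrite ler_pdivrMr// ler_peMr// mulr_ge0// exprn_ge0.
Qed.

(** The cubic bound at $s=m/\sqrt t$, multiplied by [t], is of order $t^{-1/2}$. *)
Lemma cvg_VG_phase (k g m : R) : 0 <= k ->
  t * (atan (g * (m / Num.sqrt t) / (1 + k * (m / Num.sqrt t) ^+ 2))
       - g * (m / Num.sqrt t)) @[t --> +oo%R] --> 0.
Proof.
move=> k0; apply: norm_cvg0.
pose C := (`|g| ^+ 3 + `|g| * k) * `|m| ^+ 3.
have cC : C * (Num.sqrt t)^-1 @[t --> +oo%R] --> 0.
  rewrite -[X in _ --> X](mulr0 C); apply: cvgMl_tmp.
  exact: cvg_invr_sqrt_pinfty.
apply: (squeeze_cvgr _ _ cC); last exact: cvg_cst.
near=> t; have t0 : 0 < t by near: t; exact: nbhs_pinfty_gt.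
have s0 : 0 < Num.sqrt t by rewrite sqrtr_gt0.
rewrite normr_ge0 normrM (gtr0_norm t0)/=.
rewrite (le_trans (ler_wpM2l (ltW t0) (VG_phase_le _ _ k0)))//.
rewrite normrM normfV (gtr0_norm s0) /C.
rewrite -[X in X * (_ * _)](sqr_sqrtr (ltW t0)) le_eqVlt; apply/orP; left.
by apply/eqP; field; rewrite gt_eqF.
Unshelve. all: end_near. Qed.

(** Expanding the squares, the argument of the logarithm is $1+c/t+c'/t^2$, and [c] is the limit. *)
Lemma cvg_VG_modulus (k g m : R) : 0 <= k ->
  t * ln ((1 + k * (m / Num.sqrt t) ^+ 2) ^+ 2 + (g * (m / Num.sqrt t)) ^+ 2)
    @[t --> +oo%R] --> (2 * k + g ^+ 2) * m ^+ 2.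
Proof.
move=> k0; pose c := (2 * k + g ^+ 2) * m ^+ 2; pose c' := k ^+ 2 * m ^+ 4.
have c0 : 0 <= c by rewrite mulr_ge0 ?sqr_ge0// addr_ge0 ?sqr_ge0// mulr_ge0.
have c'0 : 0 <= c' by rewrite mulr_ge0 ?sqr_ge0// exprn_even_ge0.
have cl : t * ln (1 + (c / t + c' / t / t)) @[t --> +oo%R] --> c.
  apply: cvg_mul_ln1D => [t t0|].
    by rewrite addr_ge0// !divr_ge0// ltW.
  have cc : c + c' * t^-1 @[t --> +oo%R] --> c.
    rewrite -[X in _ --> X]addr0; apply: cvgD; first exact: cvg_cst.
    rewrite -[X in _ --> X](mulr0 c'); apply: cvgMl_tmp.
    exact: cvg_invr_pinfty.
  apply: cvg_trans cc; apply: near_eq_cvg; near=> t.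
  have t0 : t != 0 by rewrite gt_eqF//; near: t; exact: nbhs_pinfty_gt.
  by field.
apply: cvg_trans cl; apply: near_eq_cvg; near=> t.
have t0 : 0 < t by near: t; exact: nbhs_pinfty_gt.
have s0 : Num.sqrt t != 0 by rewrite gt_eqF// sqrtr_gt0.
congr (_ * ln _); rewrite /c /c'.
move: (sqr_sqrtr (ltW t0)) s0; move: (Num.sqrt t) => r <- r0.
by field.
Unshelve. all: end_near. Qed.

Lemma cvg_VG_normalized_cos d (T : measurableType d) (P : probability T R)
    (mu delta sigma alpha theta a b : R) (Y : R -> {RV P >-> R}) (xi p : R) :
  0 < alpha -> 0 < theta -> 0 < b ->
  VG_Levy_process mu delta sigma alpha theta Y ->
  a = mu + alpha * theta * delta ->
  b ^+ 2 = alpha * (theta ^+ 2 * delta ^+ 2 + sigma ^+ 2 * theta) ->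
  \int[P]_w cos (xi * normalize (Y t) (t * a) (b * Num.sqrt t) w + p)
    @[t --> +oo%R] --> cos p * expR (- (xi ^+ 2 / 2)).
Proof.
move=> alpha0 theta0 b0 hY aE bE.
pose k := sigma ^+ 2 * theta / 2; pose g := delta * theta; pose m := xi / b.
have k0 : 0 <= k by rewrite divr_ge0// mulr_ge0 ?sqr_ge0// ltW.
pose L t := - (alpha / 2 * (t * ln ((1 + k * (m / Num.sqrt t) ^+ 2) ^+ 2
                                 + (g * (m / Num.sqrt t)) ^+ 2))).
(* The phase left after centring: since $a=\mu+\alpha g$, subtracting $ta$ cancels the drift and the
   linear part of the arctangent. *)
pose A t := alpha * (t * (atan (g * (m / Num.sqrt t)
                         / (1 + k * (m / Num.sqrt t) ^+ 2))
                       - g * (m / Num.sqrt t))).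
have cL : expR (L t) @[t --> +oo%R] --> expR (- (xi ^+ 2 / 2)).
  have c0 : L t @[t --> +oo%R] --> - (xi ^+ 2 / 2).
    (* Here the choice of variance enters: $b^2=\alpha(2k+g^2)$ and $m=\xi/b$. *)
    have -> : xi ^+ 2 / 2 = alpha / 2 * ((2 * k + g ^+ 2) * m ^+ 2).
      rewrite /k /g /m expr_div_n bE; field.
      have : b ^+ 2 != 0 by rewrite expf_neq0// gt_eqF.
      by rewrite bE mulf_eq0 negb_or -exprMn andbC.
    by apply: (@cvgN _ R^o); apply: cvgMl_tmp; exact: cvg_VG_modulus.
  exact: (cvg_comp _ _ c0 (@continuous_expR R _)).
have cA : cos (A t + p) @[t --> +oo%R] --> cos p.
  have c0 : A t @[t --> +oo%R] --> 0.
    rewrite -[X in _ --> X](mulr0 alpha); apply: cvgMl_tmp.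
    exact: cvg_VG_phase.
  have cp : A t + p @[t --> +oo%R] --> p.
    by rewrite -[X in _ --> X]add0r; apply: cvgD => //; exact: cvg_cst.
  exact: (cvg_comp _ _ cp (@continuous_cos R p)).
have cLA : expR (L t) * cos (A t + p) @[t --> +oo%R] -->
    cos p * expR (- (xi ^+ 2 / 2)).
  by rewrite mulrC; apply: cvgM.
apply: cvg_trans cLA; apply: near_eq_cvg; near=> t.
have t0 : 0 < t by near: t; exact: nbhs_pinfty_gt.
have s0 : 0 < Num.sqrt t by rewrite sqrtr_gt0.
pose s := m / Num.sqrt t.
(* The centring is moved into the phase, so that the characteristic function of [Y t] is used at the
   frequency $s=\xi/(b\sqrt t)$. *)
have := Rintegral_cos_char_fun (p - s * (t * a))
  (VG_char_fun theta0 hY s (ltW t0)).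
rewrite -/k -/g => cE.
transitivity (\int[P]_w cos (s * Y t w + (p - s * (t * a)))).
  rewrite cE; congr (expR _ * cos _).
    have E (l : R) : - (alpha / 2 * (t * l)) = - (t * alpha * (l / 2)) by field.
    exact: E.
  have E (v s' : R) : alpha * (t * (v - g * s')) + p =
      t * mu * s' + t * alpha * v + (p - s' * (t * a)).
    by rewrite aE /g; ring.
  exact: E.
apply: eq_Rintegral => w _; congr cos.
have E (y : R) : s * y + (p - s * (t * a)) =
    xi * ((y - t * a) * (b * Num.sqrt t)^-1) + p.
  by rewrite /s /m; field; rewrite !gt_eqF.
exact: E.
Unshelve. all: end_near. Qed.

End VG_limit.

(* [R] and [measurableTypeR R] have the same measurable sets but different
   displays, so [distribution P X] has to be retyped to be compared with
   [normal_prob]. *)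
Definition borel_valued {R : realType} d (T : measurableType d)
  (X : {mfun T >-> R}) : T -> measurableTypeR R := X.

HB.instance Definition _ (R : realType) d (T : measurableType d)
    (X : {mfun T >-> R}) :=
  @isMeasurableFun.Build _ _ T (measurableTypeR R) (borel_valued X)
    (@measurable_funPT _ _ _ _ X).

Lemma Rintegral_borel_valued {R : realType} d (T : measurableType d)
    (P : probability T R) (X : {RV P >-> R}) (f : R -> R) (M : R) :
  measurable_fun setT f -> (forall x, `|f x| <= M) ->
  \int[distribution P (borel_valued X)]_x f x = \int[P]_w f (X w).
Proof.
move=> mf fM; rewrite /Rintegral; congr fine; rewrite integral_distribution//.
  exact/measurable_EFinP.
apply: (@integrable_normr_le _ _ _ _ (f \o X) M); last by move=> w; exact: fM.
exact: (measurableT_comp mf (measurable_funPT X)).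
Qed.

Unset Implicit Arguments.

Theorem theorem3p4 (R : realType) (d : measure_display) (T : measurableType d)
  (P : probability T R) (mu delta sigma alpha theta : R)
  (Y : R -> {RV P >-> R}) (a b : R)
  (hsigma : 0 < sigma) (halpha : 0 < alpha) (htheta : 0 < theta)
  (hY : VG_Levy_process mu delta sigma alpha theta Y)
  (ha : a = mu + alpha * theta * delta)
  (hb : b ^+ 2 = alpha * (theta ^+ 2 * delta ^+ 2 + sigma ^+ 2 * theta))
  (hb0 : 0 < b) :
  cvg_in_distribution (+oo%R : set_system R)
    (fun t : R => normalize (Y t) (t * a) (b * Num.sqrt t))
    (normal_prob (0 : R) 1).
Proof.
move=> x cx.
pose X t := normalize (Y t) (t * a) (b * Num.sqrt t).
(* Convergence along the reals is tested on arbitrary sequences [u] tending to $+\infty$, since the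
   continuity theorem concerns sequences of laws. *)
apply/cvge_pinftyP => u uy.
apply: (@levy_continuity R (fun n => distribution P (borel_valued (X (u n))))
  (normal_prob 0 1) x _ cx) => xi p.
rewrite Rintegral_cos_normal_prob01.
have := @cvg_VG_normalized_cos R d T P _ _ _ _ _ _ _ _ xi p
  halpha htheta hb0 hY ha hb.
move=> /cvg_pinftyP/(_ u uy); apply: cvg_trans.
apply: near_eq_cvg; apply: nearW => n.
by rewrite (Rintegral_borel_valued (X (u n)) (measurable_cos_affine xi p)
  (fun x => cos_max _)).
Qed.
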